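(* Let $M_{\infty,1}$ be equipped with the pointwise convergence topology. Then the set $$\{(\boldsymbol f,x)\in M_{\infty,1}\times K:\ \limsup_{n\to\infty} f_n(x)=1 \text{ and } \liminf_{n\to\infty} f_n(x)=-1\}$$ is a dense $G_\delta$ subset of $M_{\infty,1}\times K$. In particular, there is a dense $G_\delta$ subset of $M_{\infty,1}$ such that for every $\boldsymbol f$ in it one has $\limsup_{n} f_n(x)=1$ and $\liminf_n f_n(x)=-1$ for all $x$ from a dense $G_\delta$ subset of $K$ (depending on $\boldsymbol f$).
   Context: Setting: $(\Omega,\Sigma,P)$ is a probability space and $(\Sigma_n)_{n\in\mathbb N}$ is a filtration of finite $\sigma$-algebras, i.e. an increasing sequence of finite $\sigma$-subalgebras of $\Sigma$. For each $n$, $\mathcal D_n$ is the finite partition of $\Omega$ (into nonempty sets) generating $\Sigma_n$; thus $\mathcal D_m$ refines $\mathcal D_n$ for $m\ge n$. Standing assumptions: (1) $P(D)>0$ for each $n\in\mathbb N$ and $D\in\mathcal D_n$; (2) for each $n\in\mathbb N$ and $D\in\mathcal D_n$ there is $m>n$ with $D\notin\mathcal D_m$. The space $K$: $K=\{(D_n)\in\prod_{n\in\mathbb N}\mathcal D_n : D_m\subset D_n \text{ for } m\ge n\}$, with the topology inherited from the product, each $\mathcal D_n$ being discrete (a metrizable compact space). Martingales: a martingale (adapted to $(\Sigma_n)$) is a sequence $\boldsymbol f=(f_n)$ with $f_n\in L^1(\Omega,\Sigma_n,P|_{\Sigma_n})$ and $\int_E f_n\,dP=\int_E f_m\,dP$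 whenever $n\le m$ and $E\in\Sigma_n$. Each $f_n$ is constant on each $D\in\mathcal D_n$; that value is denoted $f_n(D)$. For $x=(D_k)_{k}\in K$ we write $f_n(x)=f_n(D_n)$. Spaces: $M_\infty$ is the space of all martingales adapted to $(\Sigma_n)$ with $\|\boldsymbol f\|_\infty=\sup_n\|f_n\|_{L^\infty}<\infty$, and $M_{\infty,1}=\{\boldsymbol f\in M_\infty:\|\boldsymbol f\|_\infty\le1\}$. The pointwise convergence topology on $M_{\infty,1}$ is the topology inherited from the product $\prod_{n\in\mathbb N}L^\infty(\Omega,\Sigma_n,P|_{\Sigma_n})$ (each factor with its norm topology). *)

(* Defs.v *)
From HB Require Import structures.
From mathcomp Require Import all_boot all_order all_algebra.
From mathcomp Require Import all_classical all_reals all_analysis.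
From mathcomp Require Import measurable_realfun borel_hierarchy.

Set Implicit Arguments.
Unset Strict Implicit.
Unset Printing Implicit Defensive.

Import Order.TTheory GRing.Theory Num.Theory.
Import numFieldNormedType.Exports.

Local Open Scope classical_set_scope.
Local Open Scope ring_scope.

(* The restriction mu|G of a measure to a sub-sigma-algebra G (more generally
   to the sigma-algebra generated by a family G of measurable sets). *)
Section measure_restriction.
Local Open Scope ereal_scope.
Context d (T : measurableType d) (R : realType).
Variables (mu : {measure set T -> \bar R}) (G : set (set T)).
Hypothesis mG : G `<=` measurable.

Definition sub_measure of G `<=` measurable :
  set (g_sigma_algebraType G) -> \bar R := mu.

Let measurable_sub (A : set (g_sigma_algebraType G)) :
  measurable A -> d.-measurable (A : set T).
Proof. exact: (smallest_sub (@sigma_algebra_measurable _ T) mG). Qed.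

Let sub_measure0 : sub_measure mG set0 = 0.
Proof. exact: measure0. Qed.

Let sub_measure_ge0 A : 0 <= sub_measure mG A.
Proof. exact: measure_ge0. Qed.

Let sub_measure_sigma_additive : semi_sigma_additive (sub_measure mG).
Proof.
move=> F mF tF mUF; apply: (@measure_semi_sigma_additive _ T R mu F) => //.
- by move=> n; exact: measurable_sub.
- exact: measurable_sub.
Qed.

HB.instance Definition _ := isMeasure.Build _ _ _
  (sub_measure mG) sub_measure0 sub_measure_ge0 sub_measure_sigma_additive.

End measure_restriction.

(* L^oo(mu), topologized by the norm 'N[mu]_+oo.  Its elements are functions and
   not classes modulo equality mu-a.e.; the two agree when the empty set is the
   only measurable null set, as is the case for each P|Sigma_n below, since the
   atoms of Sigma_n have positive probability. *)
Section Linfty.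
Context d (T : measurableType d) (R : realType).
Variable mu : {measure set T -> \bar R}.

Definition Linfty : Type := LfunType mu (leey 1%E).

HB.instance Definition _ := Choice.on Linfty.

Definition Linfty_fun (f : Linfty) : T -> R :=
  (f : LfunType mu (leey 1%E)).

Definition Linfty_ball (f : Linfty) (e : R) (g : Linfty) : Prop :=
  ('N[mu]_+oo [EFin \o (Linfty_fun f \- Linfty_fun g)%R] < e%:E)%E.

Let ball_center f (e : R) : 0 < e -> Linfty_ball f e f.
Proof.
move=> e0; rewrite /Linfty_ball (_ : _ \o _ = cst 0%E); last first.
  by apply/funext => x /=; rewrite subrr.
by rewrite Lnorm0 ?lte_fin.
Qed.

Let ball_sym f g (e : R) : Linfty_ball f e g -> Linfty_ball g e f.
Proof.
rewrite /Linfty_ball -oppe_Lnorm; congr (_ < _)%E; congr Lnorm.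
by apply/funext => x /=; congr EFin; exact: opprB.
Qed.

Let ball_triangle f g h (e1 e2 : R) :
  Linfty_ball f e1 g -> Linfty_ball g e2 h -> Linfty_ball f (e1 + e2) h.
Proof.
rewrite /Linfty_ball => fg gh; rewrite EFinD.
apply: le_lt_trans (lteD fg gh).
have mfun (k : Linfty) : measurable_fun [set: T] (Linfty_fun k).
  exact: measurable_funPT (k : LfunType mu (leey 1%E)).
rewrite (_ : EFin \o (Linfty_fun f \- Linfty_fun h) =
   EFin \o ((Linfty_fun f \- Linfty_fun g) \+ (Linfty_fun g \- Linfty_fun h)));
  last by apply/funext => x /=; rewrite addrA subrK.
by apply: eminkowski; rewrite ?leey//; apply/measurable_EFinP; exact: measurable_funB.
Qed.

HB.instance Definition _ := hasNbhs.Build Linfty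
  (nbhs_ (entourage_ Linfty_ball)).
HB.instance Definition _ := Nbhs_isPseudoMetric.Build R Linfty
  erefl ball_center ball_sym ball_triangle erefl.

End Linfty.

Record finite_filtration d (T : measurableType d) := FiniteFiltration {
  filt :> nat -> set (set T) ;
  filt_sigma_algebra : forall n, sigma_algebra [set: T] (filt n) ;
  filt_finite : forall n, finite_set (filt n) ;
  filt_measurable : forall n, filt n `<=` measurable ;
  filt_increasing : forall m n, (m <= n)%N -> filt m `<=` filt n }.

Definition generating_partition (T : Type) (G D : set (set T)) : Prop :=
  [/\ finite_set D, partition D id [set: T] & <<s D >> = G].

(* The set K inside the product of the discrete spaces D_n; the space K is the
   subtype [set_type (branches D)], with the induced topology. *)
Definition branches (T : Type) (D : nat -> set (set T)) :
    set (prod_topology (fun n => discrete_topology (set_type (D n)))) :=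
  [set x | forall m n, (n <= m)%N -> (\val (x m) : set T) `<=` \val (x n)].
Arguments branches {T} D.

(* The value on E of a function that is constant on the nonempty set E. *)
Definition value_on (T : Type) (R : realType) (f : T -> R) (E : set T) : R :=
  xget 0 (f @` E).

Section martingales.
Context d (T : measurableType d) (R : realType).
Variables (P : probability T R) (Sigma : finite_filtration T).

Definition probS (n : nat) :
    {measure set (g_sigma_algebraType (Sigma n)) -> \bar R} :=
  sub_measure P (@filt_measurable _ _ Sigma n).

Definition martingale (f : nat -> T -> R) : Prop :=
  (forall n, (f n : g_sigma_algebraType (Sigma n) -> R) \in Lfun (probS n) 1%E) /\
  forall m n, (n <= m)%N -> forall E, Sigma n E ->
    (\int[P]_(x in E) (f n x)%:E = \int[P]_(x in E) (f m x)%:E)%E.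

Definition LinftyS : Type := prod_topology (fun n => Linfty (probS n)).
HB.instance Definition _ := Topological.on LinftyS.

Definition seq_fun (f : LinftyS) : nat -> T -> R := fun n => Linfty_fun (f n).

Definition normM (f : LinftyS) : \bar R :=
  ereal_sup (range (fun n => 'N[probS n]_+oo [EFin \o Linfty_fun (f n)]%E)).

Definition Minfty : set LinftyS :=
  [set f | martingale (seq_fun f) /\ (normM f < +oo)%E].

(* The space M_{oo,1} with the pointwise convergence topology is the subtype
   [set_type Minfty1], with the topology induced by the product [LinftyS]. *)
Definition Minfty1 : set LinftyS :=
  [set f | Minfty f /\ (normM f <= 1)%E].

Variable D : nat -> set (set T).

Definition eval (f : Minfty1) (x : branches D) (n : nat) : R :=
  value_on (seq_fun (\val f) n) (\val (\val x n)).

Definition oscillates (f : Minfty1) (x : branches D) : Prop :=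
  limn_esup (EFin \o eval f x) = 1%E /\ limn_einf (EFin \o eval f x) = (-1)%E.

End martingales.
Arguments Minfty {d T R} P Sigma.
Arguments Minfty1 {d T R} P Sigma.

(* Main.v *)
Require Import Defs.
From mathcomp Require Import all_boot all_order all_algebra.
From mathcomp Require Import all_classical all_reals all_analysis.
From mathcomp Require Import measurable_realfun borel_hierarchy ess_sup_inf.
From mathcomp Require Import ring lra.

(** Call a function of level [n] if it is constant on the atoms of [Sigma n].
    A martingale bounded by 1 is then a coherent family of values in [-1, 1]
    on the tree of all atoms, the value at an atom being the mean of the values
    at its sub-atoms, and a point of [K] is an infinite branch of this tree.
    Along a branch the limsup is 1 and the liminf is -1 exactly when, for every
    [k], some value at a level at least [k] exceeds [1 - 1/(k+1)] and some value
    at a level at least [k] lies below [-1 + 1/(k+1)] ([oscillatesP]).  A value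
    at level [n] depends continuously on the martingale and is locally constant
    in the branch, so these conditions are open ([open_peaks]), and the set of
    the theorem and all its sections are countable intersections of open sets.

    Density rests on one construction ([level_step]).  Let [v] be of level [n]
    with values in [-c, c], where [c < 1], and let [a] be a target in the open
    interval from -1 to 1.  Since atoms keep splitting, each atom [E] of level
    [n] contains an atom [A] of some later level whose probability relative to
    [E] is as small as desired ([small_atoms]).  Give [A] the value [a] and
    spread the compensation evenly over the rest of [E]: as [A] is tiny, the
    compensated value barely moves and all values stay uniformly below 1 in
    modulus.  So the step can be iterated, and conditional expectations of the
    iterates form a martingale in the unit ball with the prescribed values below
    every node ([Minfty1_extension]).

    Given [f] in the unit ball, apply this to [(1 - 1/(n+2)) * f n] with targets
    approaching 1 and -1 alternately.  The resulting martingales converge to [f]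
    as [n] grows, and below every node each of them comes arbitrarily close to
    1 and to -1.  The martingales having this last property form the dense
    G-delta set of the second assertion ([open_peaks_below],
    [dense_peaks_below]): for such a martingale one descends from any node to a
    node of value near 1, then to one of value near -1, and so on, which yields
    oscillating branches through every node ([dense_section]).  Density in the
    product follows, first choosing the martingale and then the branch.  The
    explicit constructions take the place of the Baire category and
    Kuratowski-Ulam theorems. *)

Set Implicit Arguments.
Unset Strict Implicit.
Unset Printing Implicit Defensive.

Import Order.TTheory GRing.Theory Num.Theory.
Import numFieldNormedType.Exports.

Local Open Scope classical_set_scope.
Local Open Scope ring_scope.

(** * Limsup and liminf of sequences bounded by one *)

Lemma limn_esup_eq1 (R : realType) (u : R^nat) : (forall n, u n <= 1) ->
  limn_esup (EFin \o u) = 1%E <->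
  forall k, exists2 n, (k <= n)%N & 1 - k.+1%:R^-1 < u n.
Proof.
move=> u1; rewrite /limn_esup limf_esupE; split=> [lim1 k|near1].
  have : (1 <= ereal_sup ((EFin \o u) @` [set n | (k <= n)%N]))%E.
    rewrite -[leLHS]lim1; apply: ereal_inf_lbound.
    by exists [set n | (k <= n)%N] => //; exists k.
  move=> /(@lt_le_trans _ _ _ (1 - k.+1%:R^-1)%:E) h.
  have /ereal_sup_gt[_ [n kn <-]] : ((1 - k.+1%:R^-1)%:E <
      ereal_sup ((EFin \o u) @` [set n | (k <= n)%N]))%E.
    by apply: h; rewrite lte_fin ltrBlDr ltrDl invr_gt0 ltr0n.
  by rewrite lte_fin => ukn; exists n.
apply/eqP; rewrite eq_le; apply/andP; split.
  apply: (@le_trans _ _ (ereal_sup ((EFin \o u) @` setT))).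
    by apply: ereal_inf_lbound; exists setT => //; exact: filterT.
  by apply: ge_ereal_sup => _ [n _ <-]; rewrite lee_fin.
apply: le_ereal_inf_tmp => _ [V [k0 _ k0V] <-].
apply/lee_addgt0Pr => e e0.
have [k1 _ k1e] := near_infty_natSinv_lt (PosNum e0).
have [n kn un] := near1 (maxn k0 k1).
apply: (@le_trans _ _ ((u n)%:E + e%:E)%E); last first.
  rewrite leeD2r//; apply: ereal_sup_ubound; exists n => //.
  by apply: k0V => /=; rewrite (leq_trans _ kn)// leq_maxl.
rewrite -EFinD lee_fin -lerBlDr; apply: le_trans (ltW un).
by rewrite lerD2l lerN2 ltW//; apply: k1e => /=; rewrite leq_maxr.
Qed.

Lemma limn_einf_eqN1 (R : realType) (u : R^nat) : (forall n, -1 <= u n) ->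
  limn_einf (EFin \o u) = (-1)%E <->
  forall k, exists2 n, (k <= n)%N & 1 - k.+1%:R^-1 < - u n.
Proof.
move=> u1; rewrite -(@limn_esup_eq1 _ (\- u)); last first.
  by move=> n; rewrite lerNl.
rewrite /limn_einf (_ : (\- (EFin \o u))%E = EFin \o \- u); last by [].
split=> [/eqP|->//]; by rewrite eqe_oppLR oppeK => /eqP.
Qed.

(** * Convergence in the spaces of branches and of martingales *)

Lemma cvg_initial (S : choiceType) (X : topologicalType) (f : S -> X)
    (F : set_system S) (s : S) :
  Filter F -> f @ F --> f s -> F --> (s : initial_topology f).
Proof.
move=> FF fF A [_ [[B oB <-] /= Bs] sBA].
by apply: filterS sBA _; apply: fF; apply: open_nbhs_nbhs.
Qed.

(** Both spaces of the theorem are subspaces of countable products, so this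
    characterization by coordinates gives all that is used of their topologies:
    neighborhoods (apply it to the filter [nbhs x]) and limits of sequences. *)
Lemma cvg_subprod (X : nat -> topologicalType) (A : set (prod_topology X))
    (F : set_system (set_type A)) (x : set_type A) : Filter F ->
  F --> x <-> forall n,
    (fun y : A => (\val y : prod_topology X) n) @ F -->
      (\val x : prod_topology X) n.
Proof.
move=> FF; split=> [Fx n|Fx].
  have c1 : (\val : set_type A -> prod_topology X) @ F --> \val x.
    by apply: cvg_trans (cvg_app _ Fx) _; exact: initial_continuous.
  exact: cvg_trans (cvg_app _ c1) (@proj_continuous _ X n _).
apply: cvg_initial; apply/cvg_sup => n.
by apply: cvg_initial; exact: Fx.
Qed.

Lemma near_all_seq (X : topologicalType) (I : eqType) (r : seq I) (x : X) (Q : I -> X -> Prop) :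
  (forall i, i \in r -> \forall y \near x, Q i y) ->
  \forall y \near x, forall i, i \in r -> Q i y.
Proof.
elim: r => [|i r ih] h; first by apply: nearW.
have := h i (mem_head _ _); have := ih (fun j jr => h j (@mem_behead _ (i :: r) j jr)).
apply: filterS2 => y yr yi j; rewrite inE => /orP[/eqP->//|]; exact: yr.
Qed.

Lemma dense_cvg_seq (X : topologicalType) (S : set X) :
  (forall x : X, exists2 u : nat -> X, (forall n, S (u n)) & u @ \oo --> x) -> dense S.
Proof.
move=> h O [x Ox] oO; have [u Su ux] := h x.
have [n _ nO] := ux O (open_nbhs_nbhs (conj oO Ox)).
by exists (u n); split => //; exact: nO (leqnn n).
Qed.

Section spaces.
Context d (T : measurableType d) (R : realType).
Variables (P : probability T R) (Sigma : finite_filtration T).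
Variable D : nat -> set (set T).

Lemma near_branches (x : branches D) n :
  \forall y \near x, (\val y : prod_topology _) n = (\val x : prod_topology _) n.
Proof.
have /(cvg_subprod x) h : nbhs x --> x by [].
by have /discrete_cvg := h n.
Qed.

Lemma cvg_branches (u : nat -> branches D) (x : branches D) :
  (forall n, \forall k \near \oo,
    (\val (u k) : prod_topology _) n = (\val x : prod_topology _) n) ->
  u @ \oo --> x.
Proof.
by move=> h; apply/cvg_subprod => n; apply/discrete_cvg; exact: h.
Qed.

Lemma near_Minfty1 (f : Minfty1 P Sigma) n (e : R) : 0 < e ->
  \forall g \near f,
    Linfty_ball ((\val f : LinftyS P Sigma) n) e ((\val g : LinftyS P Sigma) n).
Proof.
move=> e0.
have /(cvg_subprod f) h : nbhs f --> f by [].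
by have /cvg_ballP := h n; exact.
Qed.

Lemma cvg_Minfty1 (u : nat -> Minfty1 P Sigma) (f : Minfty1 P Sigma) :
  (forall n e, 0 < e -> \forall k \near \oo,
    Linfty_ball ((\val f : LinftyS P Sigma) n) e
      ((\val (u k) : LinftyS P Sigma) n)) ->
  u @ \oo --> f.
Proof.
move=> h; apply/cvg_subprod => n; apply/cvg_ballP => e e0; exact: h.
Qed.

End spaces.

(** * Atoms of a finite filtration *)

Section atoms.
Context d (T : measurableType d).
Variables (Sigma : finite_filtration T) (D : nat -> set (set T)).
Hypothesis hD : forall n, generating_partition (Sigma n) (D n).

Definition atom n (t : T) : set T := [set s | exists E, [/\ D n E, E t & E s]].

Lemma atomE n E t : D n E -> E t -> atom n t = E.
Proof.
move=> DE Et; apply/seteqP; split=> [s [F [DF Ft Fs]]|s Es]; last by exists E.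
have [_ [_ triv _] _] := hD n.
by rewrite (triv _ _ DE DF)//; exists t.
Qed.

Lemma D_ex n t : exists2 E, D n E & E t.
Proof.
have [_ [cov _ _] _] := hD n.
by have [E DE Et] : cover (D n) id t by [rewrite cov|]; exists E.
Qed.

Lemma D_neq0 n E : D n E -> E !=set0.
Proof. by have [_ [_ _ ne] _] := hD n; exact: ne. Qed.

Lemma D_atom n t : D n (atom n t).
Proof. by have [E DE Et] := D_ex n t; rewrite (atomE DE Et). Qed.

Lemma atom_refl n t : atom n t t.
Proof. by have [E DE Et] := D_ex n t; rewrite (atomE DE Et). Qed.

Lemma eq_atom n s t : atom n t s -> atom n s = atom n t.
Proof. by move=> ts; apply: atomE => //; exact: D_atom. Qed.

Lemma D_ex_atom n E : D n E -> exists t, E = atom n t.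
Proof. by move=> DE; have [t Et] := D_neq0 DE; exists t; rewrite (atomE DE). Qed.

Lemma sub_Sigma n E : D n E -> Sigma n E.
Proof. by have [_ _ <-] := hD n => DE; exact: sub_sigma_algebra. Qed.

Lemma measurable_atom n t : measurable (atom n t).
Proof. by apply: (@filt_measurable _ _ Sigma n); exact/sub_Sigma/D_atom. Qed.

(** The sets that contain or avoid each atom form a sigma-algebra containing the
    generating partition. *)
Lemma Sigma_atom n E t : Sigma n E -> E t -> atom n t `<=` E.
Proof.
have [_ _ <-] := hD n => SE.
pose G := [set E : set T | forall t, E t -> atom n t `<=` E].
suff: G E by exact.
apply: SE; split=> [|F DF s Fs]; last by rewrite (atomE DF).
split=> [s []//|F GF s [_ nFs]|F GF s [i _ Fis] r rs]; last first.
  by exists i => //; exact: GF rs.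
move=> r rs; split=> // Fr; apply: nFs; apply: GF Fr _ _.
by rewrite (eq_atom rs); exact: atom_refl.
Qed.

(** A union of atoms is a finite union, since there are finitely many atoms. *)
Lemma Sigma_saturated n E : (forall t, E t -> atom n t `<=` E) -> Sigma n E.
Proof.
move=> sat; have [fin _ gen] := hD n.
rewrite (_ : E = \bigcup_(F in D n `&` [set F | F `<=` E]) F); last first.
  apply/seteqP; split=> [t Et|t [F [_ +] Ft]]; last exact.
  by exists (atom n t); [split; [exact: D_atom|exact: sat]|exact: atom_refl].
rewrite -(measurable_g_measurableTypeE (filt_sigma_algebra Sigma n)).
apply: fin_bigcup_measurable; first exact: finite_setIl.
by move=> F [/sub_Sigma SF _]; exact: sub_sigma_algebra.
Qed.

Lemma atom_mono m n t : (n <= m)%N -> atom m t `<=` atom n t.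
Proof.
move=> nm; apply: Sigma_atom; last exact: atom_refl.
by apply: (filt_increasing nm); exact/sub_Sigma/D_atom.
Qed.

Definition level (Y : Type) n (f : T -> Y) : Prop :=
  forall t s, atom n t s -> f s = f t.

Lemma level_Sigma (Y : Type) n (f : T -> Y) (B : set Y) :
  level n f -> Sigma n (f @^-1` B).
Proof.
by move=> lf; apply: Sigma_saturated => t Bt s ts /=; rewrite (lf _ _ ts).
Qed.

Lemma level_measurable_filt (R : realType) n (f : T -> R) : level n f ->
  measurable_fun setT (f : g_sigma_algebraType (Sigma n) -> R).
Proof.
by move=> lf _ B _; rewrite setTI; apply: sub_sigma_algebra; exact: level_Sigma.
Qed.

Lemma level_measurable (R : realType) n (f : T -> R) :
  level n f -> measurable_fun setT f.
Proof.
move=> lf _ B _; rewrite setTI; apply: (@filt_measurable _ _ Sigma n).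
exact: level_Sigma.
Qed.

(** The level set of [f] through [t] is a measurable set containing [t], hence
    contains the whole atom of [t]. *)
Lemma measurable_level (R : realType) n (f : T -> R) :
  measurable_fun setT (f : g_sigma_algebraType (Sigma n) -> R) -> level n f.
Proof.
move=> mf t s ts.
have : Sigma n (f @^-1` [set f t]).
  rewrite -(measurable_g_measurableTypeE (filt_sigma_algebra Sigma n)).
  by rewrite -[X in measurable X]setTI; exact: mf.
by move=> SB; apply: (Sigma_atom SB _ ts).
Qed.

End atoms.

(** * Norms and integrals of functions constant on atoms *)

Section filtration.
Context d (T : measurableType d) (R : realType).
Variables (P : probability T R) (Sigma : finite_filtration T).
Variable D : nat -> set (set T).
Hypothesis hD : forall n, generating_partition (Sigma n) (D n).
Hypothesis hpos : forall n E, D n E -> (0 < P E)%E.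

Local Notation atom := (atom D).
Local Notation level := (level D).

Lemma Linfty_norm_le n (f : T -> R) (c : R) : 0 <= c -> (forall t, `|f t| <= c) ->
  ('N[probS P Sigma n]_+oo[EFin \o f] <= c%:E)%E.
Proof.
move=> c0 fc; rewrite unlock; case: ifP => _; last by rewrite lee_fin.
by apply/ess_supP; apply: nearW => t; rewrite /= lee_fin.
Qed.

(** The essential supremum is a pointwise bound here, because a null set of
    [Sigma n] cannot contain an atom. *)
Lemma le_Linfty_norm n (f : T -> R) t : level n f ->
  (`|f t|%:E <= 'N[probS P Sigma n]_+oo[EFin \o f])%E.
Proof.
move=> lf; rewrite unlock ifT; last first.
  by rewrite [ltRHS](@probability_setT _ _ _ P)// lte01.
rewrite leNgt; apply/negP => ft.
have [A [mA A0 sA]] := ess_sup_ge (probS P Sigma n) (abse \o (EFin \o f)).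
have SA : Sigma n A.
  by rewrite -(measurable_g_measurableTypeE (filt_sigma_algebra Sigma n)).
have At : A t by apply: sA => /=; apply/negP; rewrite -ltNge.
have : (P (atom n t) <= P A)%E.
  apply: le_measure; rewrite ?inE.
  - exact: measurable_atom hD n t.
  - exact: filt_measurable SA.
  - exact: Sigma_atom hD _ _ _ SA At.
apply/negP; rewrite -ltNge [ltLHS]A0.
by apply: hpos; exact: D_atom hD n t.
Qed.

Definition prob (E : set T) : R := fine (P E).

Lemma probE E : measurable E -> P E = (prob E)%:E.
Proof. by move=> mE; rewrite /prob fineK// fin_num_measure. Qed.

Lemma prob_atom_gt0 n t : 0 < prob (atom n t).
Proof.
rewrite -lte_fin -probE//; last exact: measurable_atom hD n t.
by apply: hpos; exact: D_atom hD n t.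
Qed.

Lemma integral_level n t (v : T -> R) : level n v ->
  (\int[P]_(x in atom n t) (v x)%:E = (v t * prob (atom n t))%:E)%E.
Proof.
move=> lv; rewrite (eq_integral (cst (v t)%:E)); last first.
  by move=> x; rewrite inE => tx; rewrite /= (lv _ _ tx).
have m := measurable_atom hD n t.
by rewrite integral_cst// EFinM; congr (_ * _)%E; exact: probE.
Qed.

Lemma eq_integral_atoms n (v w : T -> R) :
  measurable_fun setT v -> measurable_fun setT w ->
  (forall t, (\int[P]_(x in atom n t) (v x)%:E =
              \int[P]_(x in atom n t) (w x)%:E)%E) ->
  forall E, Sigma n E ->
    (\int[P]_(x in E) (v x)%:E = \int[P]_(x in E) (w x)%:E)%E.
Proof.
move=> mv mw vw E SE.
have [/finite_seqP[s Ds] [_ triv _] _] := hD n.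
pose s' := undup [seq F <- s | `[< F `<=` E >]].
have s'P F : (F \in s') = (F \in s) && `[< F `<=` E >] by rewrite mem_undup mem_filter andbC.
have s'D F : F \in s' -> D n F by rewrite s'P Ds => /andP[].
pose G F := if F \in s' then F else set0.
have mG F : measurable (G F).
  rewrite /G; case: ifP => // /s'D /(D_ex_atom hD)[t ->].
  exact: measurable_atom hD n t.
have EE : E = \big[setU/set0]_(F <- s') G F.
  rewrite -bigcup_seq; apply/seteqP; split=> [t Et|t [F /= Fs']].
    have as' : atom n t \in s'.
      rewrite s'P; apply/andP; split; last exact/asboolP/(Sigma_atom hD SE).
      by have := D_atom hD n t; rewrite Ds.
    by exists (atom n t) => //; rewrite /G as'; exact: atom_refl hD n t.
  by rewrite /G Fs'; move: Fs'; rewrite s'P => /andP[_ /asboolP]; exact.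
have tG : trivIset [set` s'] G.
  move=> A B As' Bs' [t]; rewrite /G As' Bs' => ABt.
  by apply: triv; [exact: s'D|exact: s'D|exists t].
have us' : uniq s' by exact: undup_uniq.
rewrite EE !integral_bigsetU_EFin//; last first.
- by apply/measurable_EFinP; exact: measurable_funTS.
- by apply/measurable_EFinP; exact: measurable_funTS.
rewrite !big_seq; apply: eq_bigr => F Fs'.
by rewrite /G Fs'; have [t ->] := D_ex_atom hD (s'D _ Fs').
Qed.
Lemma integrable_bounded (E : set T) (v : T -> R) (c : R) : measurable E ->
  measurable_fun setT v -> (forall t, `|v t| <= c) -> P.-integrable E (EFin \o v).
Proof.
move=> mE mv vc; apply: measurable_bounded_integrable => //.
- by rewrite (le_lt_trans (probability_le1 P mE))// ltry.
- exact: measurable_funTS.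
- by exists c; split; [exact: num_real|move=> r cr t _; exact: le_trans (vc t) (ltW cr)].
Qed.

(** The conditional expectation of [v] given [Sigma n]. *)
Definition avg n (v : T -> R) (t : T) : R :=
  fine (\int[P]_(x in atom n t) (v x)%:E) / prob (atom n t).

Lemma avg_level n (v : T -> R) : level n (avg n v).
Proof. by move=> t s ts; rewrite /avg (eq_atom hD ts). Qed.

Lemma avg_id n (v : T -> R) t : level n v -> avg n v t = v t.
Proof.
by move=> lv; rewrite /avg integral_level//= mulfK// gt_eqF// prob_atom_gt0.
Qed.

Lemma avg_le n (v : T -> R) c t : measurable_fun setT v -> (forall t, `|v t| <= c) ->
  `|avg n v t| <= c.
Proof.
move=> mv vc; have mE := measurable_atom hD n t.
have iv := integrable_bounded mE mv vc.
rewrite /avg normrM normfV (gtr0_norm (prob_atom_gt0 n t)) ler_pdivrMr ?prob_atom_gt0//.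
apply: (le_trans (le_normr_Rintegral mE iv)).
have -> : c * prob (atom n t) = \int[P]_(x in atom n t) (cst c x).
  by rewrite Rintegral_cst.
apply: le_Rintegral => //.
- apply: (@integrable_bounded _ _ c) => // [|s]; last by rewrite normr_id.
  exact: measurableT_comp.
- by apply: (@integrable_bounded _ _ `|c|).
Qed.

Lemma integral_avg n (v : T -> R) c :
  measurable_fun setT v -> (forall t, `|v t| <= c) -> forall E, Sigma n E ->
  (\int[P]_(x in E) (avg n v x)%:E = \int[P]_(x in E) (v x)%:E)%E.
Proof.
move=> mv vc; apply: eq_integral_atoms => //.
  exact: (level_measurable hD (@avg_level n v)).
move=> t; rewrite (integral_level _ (@avg_level n v)) /avg.
rewrite divfK ?gt_eqF ?prob_atom_gt0// fineK//.
have mE := measurable_atom hD n t.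
exact: (integrable_fin_num mE (integrable_bounded mE mv vc)).
Qed.

Lemma Minfty1_level (f : Minfty1 P Sigma) n : level n (seq_fun (\val f) n).
Proof.
apply: (measurable_level hD).
exact: (measurable_funPT
  ((\val f : LinftyS P Sigma) n : LfunType (probS P Sigma n) (leey 1%E))).
Qed.

Lemma Minfty1_le1 (f : Minfty1 P Sigma) n t : `|seq_fun (\val f) n t| <= 1.
Proof.
have /set_mem[_ f1] := valP f.
rewrite -lee_fin (le_trans (le_Linfty_norm _ (Minfty1_level f (n:=n))))//.
by apply: le_trans f1; apply: ereal_sup_ubound; exists n.
Qed.

Lemma Minfty1_martingale (f : Minfty1 P Sigma) m n E :
  (n <= m)%N -> Sigma n E ->
  (\int[P]_(x in E) (seq_fun (\val f) n x)%:E =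
   \int[P]_(x in E) (seq_fun (\val f) m x)%:E)%E.
Proof. by have /set_mem[[[_ h] _] _] := valP f => nm SE; exact: h. Qed.

(** Together with the three preceding lemmas, this reduces the unit ball to its
    concrete description: the sequences of level functions bounded by 1 that
    satisfy the integral identities. *)
Lemma Minfty1_exists (f : nat -> T -> R) :
  (forall n, level n (f n)) -> (forall n t, `|f n t| <= 1) ->
  (forall m n, (n <= m)%N -> forall E, Sigma n E ->
    (\int[P]_(x in E) (f n x)%:E = \int[P]_(x in E) (f m x)%:E)%E) ->
  exists F : Minfty1 P Sigma, seq_fun (\val F) = f.
Proof.
move=> lf f1 fmart.
have mf n := level_measurable_filt hD (lf n).
have Nf n := Linfty_norm_le n ler01 (f1 n).
have Lf n : (f n : g_sigma_algebraType (Sigma n) -> R) \in Lfun (probS P Sigma n) +oo%E.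
  apply/andP; rewrite !inE; split; first exact: mf.
  exact: (le_lt_trans (Nf n) (ltry _)).
pose F : LinftyS P Sigma := fun n => Lfun_Sub (leey 1%E) (Lf n).
have Ff : seq_fun F = f by [].
have NF : (normM F <= 1)%E.
  apply: ge_ereal_sup => _ [n _ <-].
  by rewrite -[Linfty_fun (F n)]/(seq_fun F n) Ff; exact: Nf.
suff FM : F \in Minfty1 P Sigma by exists (exist _ F FM).
rewrite inE; split => //; split; last by rewrite (le_lt_trans NF)// ltry.
split; last by move=> m n nm E SE; rewrite Ff; exact: fmart.
move=> n; rewrite Ff; apply/Lfun1_integrable.
apply: measurable_bounded_integrable => //.
- by rewrite [ltLHS](@probability_setT _ _ _ P) ltry.
- by exists 1; split; [exact: num_real|move=> r cr t _; exact: le_trans (f1 n t) (ltW cr)].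
Qed.

(** * Steering a bounded function to a prescribed value *)

Hypothesis hsplit : forall n E, D n E -> exists2 m, (n < m)%N & ~ D m E.

Lemma prob_le A B : measurable A -> measurable B -> A `<=` B -> prob A <= prob B.
Proof.
by move=> mA mB AB; rewrite -lee_fin -!probE// le_measure// inE.
Qed.

(** An atom that has split contains two disjoint atoms, one of which has at most
    half of its probability. *)
Lemma halving_atom n t : exists2 m, (n < m)%N &
  exists2 s, atom n t s & 2 * prob (atom m s) <= prob (atom n t).
Proof.
have [m nm nDm] := hsplit (D_atom hD n t); exists m => //.
have mA k s := measurable_atom hD k s.
have [s ts nms] : exists2 s, atom n t s & ~ atom m t s.
  apply: contrapT => nex; apply: nDm.
  suff -> : atom n t = atom m t by exact: D_atom.
  apply/seteqP; split=> [s ts|]; last exact/(atom_mono hD)/ltnW.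
  by apply: contrapT => nms; apply: nex; exists s.
have disj : atom m t `&` atom m s = set0.
  apply/seteqP; split=> // r [tr sr]; apply: nms.
  by rewrite -(eq_atom hD tr) (eq_atom hD sr); exact: (atom_refl hD m s).
have sub : atom m t `|` atom m s `<=` atom n t.
  move=> r [/(atom_mono hD (ltnW nm))//|/(atom_mono hD (ltnW nm))].
  by rewrite (eq_atom hD ts).
have sum : prob (atom m t) + prob (atom m s) <= prob (atom n t).
  have := prob_le (measurableU _ _ (mA m t) (mA m s)) (mA n t) sub.
  apply: le_trans; rewrite -lee_fin EFinD -!probE//; last exact: measurableU.
  by rewrite measureU.
have [mts|smt] := leP (prob (atom m t)) (prob (atom m s)).
  by exists t; [exact: (atom_refl hD n t)|lra].
by exists s => //; lra.
Qed.

Lemma small_atom k n t : exists2 m, (n <= m)%N &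
  exists2 s, atom n t s & 2 ^+ k * prob (atom m s) <= prob (atom n t).
Proof.
elim: k => [|k [m nm [s ts ih]]].
  by exists n => //; exists t; [exact: (atom_refl hD n t)|rewrite expr0 mul1r].
have [l ml [r sr lr]] := halving_atom m s.
exists l; first exact: leq_trans nm (ltnW ml).
exists r; last by rewrite exprSr -mulrA (le_trans _ ih)// ler_wpM2l ?exprn_ge0.
by rewrite -(eq_atom hD ts); exact: (atom_mono hD nm).
Qed.

(** The level [m] serves all atoms of level [n] at once: take the largest of the
    finitely many levels that serve them individually, passing to sub-atoms. *)
Lemma small_atoms n (e : R) : 0 < e -> exists2 m, (n < m)%N &
  forall t, exists2 s, atom n t s & prob (atom m s) <= e * prob (atom n t).
Proof.
move=> e0; pose k := Num.bound e^-1.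
have ek : 1 <= e * 2 ^+ k.
  have : e^-1 < k%:R by rewrite archi_boundP// invr_ge0 ltW.
  have : (k%:R : R) <= 2 ^+ k by rewrite -natrX ler_nat ltnW// ltn_expl.
  move=> /[swap]/lt_le_trans/[apply] /ltW h.
  by rewrite -[leLHS](@mulfV _ e) ?gt_eqF// ler_pM2l.
have /choice[M MP] : forall E, exists M, D n E -> exists2 s, E s &
    forall m, (M <= m)%N -> prob (atom m s) <= e * prob E.
  move=> E; have [DE|] := pselect (D n E); last by exists 0%N.
  have [t Et] := D_ex_atom hD DE.
  have [m nm [s ts sm]] := small_atom k n t.
  exists m => _; exists s; first by rewrite Et.
  move=> m' mm'; rewrite Et.
  have : prob (atom m' s) <= prob (atom m s).
    by apply: prob_le; [exact: measurable_atom|exact: measurable_atom|exact: atom_mono].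
  move=> /le_trans; apply; apply: (@le_trans _ _ (e * (2 ^+ k * prob (atom m s)))).
    by rewrite mulrA ler_peMl// ltW// prob_atom_gt0.
  by rewrite ler_wpM2l// ltW.
have [/finite_seqP[s Ds] _ _] := hD n.
exists (maxn n.+1 (\max_(E <- s) M E)) => [|t]; first by rewrite leq_max ltnSn.
have Dt := D_atom hD n t.
have [r tr rP] := MP _ Dt; exists r => //; apply: rP.
by rewrite leq_max (@leq_bigmax_seq _ s xpredT M)// ?orbT//; rewrite Ds in Dt.
Qed.

(** The new function has the value [a] on a small part [B] of each atom and a
    constant compensating value on the rest.  If [p] is the relative probability
    of [B], the compensating value is [(v - p * a) / (1 - p)], whose modulus is
    at most [(c + p) / (1 - p)]; this is below 1 once [p] is less than
    [(1 - c) / 2]. *)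
Lemma level_step n (v : T -> R) (c a : R) : level n v -> 0 <= c < 1 ->
  (forall t, `|v t| <= c) -> `|a| < 1 ->
  exists m w c', [/\ (n < m)%N, level m w, 0 <= c' < 1, forall t, `|w t| <= c' &
    (forall E, Sigma n E -> (\int[P]_(x in E) (v x)%:E = \int[P]_(x in E) (w x)%:E)%E) /\
    forall t, exists2 s, atom n t s & w s = a].
Proof.
move=> lv /andP[c0 c1] vc a1.
have mA k s := measurable_atom hD k s.
have [e e0 eE] : exists2 e : R, 0 < e & e = (1 - c) / 4.
  by exists ((1 - c) / 4) => //; lra.
have [m nm small] := small_atoms n e0.
(* The small atom inside E is represented by one of its points, S E. *)
have /choice[S SE] : forall E, exists s, D n E -> E s /\ prob (atom m s) <= e * prob E.
  move=> E; have [DE|nDE] := pselect (D n E); last first.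
    have [t _] : [set: T] !=set0.
    apply/set0P/eqP => T0; have := probability_setT P.
    by rewrite T0 measure0 => /esym/eqP; rewrite eqe oner_eq0.
  by exists t.
  by have [t ->] := D_ex_atom hD DE; have [s] := small t; exists s.
pose B t := atom m (S (atom n t)).
pose p t := prob (B t) / prob (atom n t).
pose b t := (v t - p t * a) / (1 - p t).
pose w t := if `[< B t t >] then a else b t.
have PA k s : 0 < prob (atom k s) := prob_atom_gt0 k s.
have BA t : B t `<=` atom n t.
  have [St _] := SE _ (D_atom hD n t).
  by rewrite -(eq_atom hD St); exact/(atom_mono hD)/ltnW.
have p0 t : 0 < p t := divr_gt0 (PA _ _) (PA _ _).
have pe t : p t <= e by rewrite /p ler_pdivrMr//; have [] := SE _ (D_atom hD n t).
have eqBpb t s : atom n t s -> [/\ B s = B t, p s = p t & b s = b t].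
  move=> ts; have Ets := eq_atom hD ts.
  have EB : B s = B t by rewrite /B Ets.
  have Ep : p s = p t by rewrite /p EB Ets.
  by split=> //; rewrite /b Ep (lv _ _ ts).
have bc t : `|b t| <= (c + e) / (1 - e).
  have pt0 := p0 t; have pte := pe t; rewrite /b.
  have num : `|v t - p t * a| <= c + e.
    apply: le_trans (ler_normB _ _) _; apply: lerD => //.
    by rewrite normrM gtr0_norm// -[leRHS]mulr1 ler_pM// ltW.
  have e1 : e < 1 by lra.
  have p1 : 0 < 1 - p t by lra.
  rewrite normrM normfV (gtr0_norm p1); apply: ler_pM => //.
    by rewrite invr_ge0 ltW.
  by rewrite lef_pV2 ?posrE; lra.
have c'1 : (c + e) / (1 - e) < 1 by rewrite ltr_pdivrMr; lra.
have lw : level m w.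
  move=> t s ts; have [EB Ep Eb] := eqBpb _ _ (atom_mono hD (ltnW nm) ts).
  rewrite /w EB Eb; congr (if _ then _ else _).
  apply/asboolP/asboolP => [Bs|Bt].
    rewrite /B -(eq_atom hD Bs) (eq_atom hD ts); exact: (atom_refl hD m t).
  by rewrite /B -(eq_atom hD Bt).
exists m, w, (Num.max `|a| ((c + e) / (1 - e))); split => //.
- by rewrite le_max normr_ge0 gt_max a1.
- by move=> t; rewrite /w le_max; case: ifP => _; rewrite ?lexx// bc orbT.
split; last first.
  move=> t; exists (S (atom n t)); first by have [] := SE _ (D_atom hD n t).
  rewrite /w ifT//; apply/asboolP.
  have [St _] := SE _ (D_atom hD n t).
  have [-> _ _] := eqBpb _ _ St; exact: (atom_refl hD m).
have mv := level_measurable hD lv; have mw := level_measurable hD lw.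
apply: eq_integral_atoms => // t; rewrite (integral_level _ lv).
have mB : measurable (B t) by exact: mA.
have mC : measurable (atom n t `\` B t) by exact: measurableD.
have EBC : atom n t = B t `|` (atom n t `\` B t).
  by rewrite setDUK//; exact: BA.
have BC : B t `&` (atom n t `\` B t) = set0 by rewrite setDIK.
have PE : prob (atom n t) = prob (B t) + prob (atom n t `\` B t).
  apply: EFin_inj; rewrite EFinD -!probE// -measureU//.
  by rewrite -EBC.
rewrite [in RHS]EBC integral_setU//; first last.
- exact/eqP.
- by apply/measurable_EFinP; exact: measurable_funTS.
rewrite (eq_integral (cst a%:E)); last first.
  move=> x; rewrite inE => Bx /=; rewrite /w ifT//; apply/asboolP.
  by have [-> _ _] := eqBpb _ _ (BA _ _ Bx).
rewrite [X in (_ + X)%E](eq_integral (cst (b t)%:E)); last first.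
  move=> x; rewrite inE => -[Ex nBx] /=; rewrite /w.
  by have [-> _ ->] := eqBpb _ _ Ex; rewrite ifF//; apply/asboolPn.
rewrite !integral_cst//.
transitivity (a%:E * (prob (B t))%:E +
              (b t)%:E * (prob (atom n t `\` B t))%:E)%E; last first.
  by congr (_ * _ + _ * _)%E; exact/esym/probE.
rewrite -!EFinM -EFinD; congr EFin.
have hp : prob (B t) = p t * prob (atom n t) by rewrite divfK// gt_eqF.
have hb : b t * (1 - p t) = v t - p t * a.
  rewrite divfK// gt_eqF//; by have := pe t; lra.
have -> : prob (atom n t `\` B t) = (1 - p t) * prob (atom n t).
  by rewrite PE in hp *; lra.
by rewrite mulrA hb hp; ring.
Qed.
(** * Martingales with prescribed values below every node *)

(** Iteration of [level_step]; the strict bound below 1, which changes at each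
    step, is what keeps the iteration going. *)
Lemma level_tower n (v : T -> R) (c : R) (a : nat -> R) :
  level n v -> 0 <= c < 1 -> (forall t, `|v t| <= c) -> (forall k, `|a k| < 1) ->
  exists (N : nat -> nat) (V : nat -> T -> R), [/\ N 0 = n, V 0 = v,
    forall k, [/\ level (N k) (V k) & forall t, `|V k t| <= 1] &
    forall k, [/\ (N k < N k.+1)%N,
      forall E, Sigma (N k) E ->
        (\int[P]_(x in E) (V k x)%:E = \int[P]_(x in E) (V k.+1 x)%:E)%E &
      forall t, exists2 s, atom (N k) t s & V k.+1 s = a k]].
Proof.
move=> lv c01 vc a1.
(* A state consists of the step number, a level, a function and its bound. *)
pose st : Type := (nat * nat * (T -> R) * R)%type.
pose inv (x : st) :=
  [/\ level x.1.1.2 x.1.2, 0 <= x.2 < 1 & forall t, `|x.1.2 t| <= x.2].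
pose nxt (x y : st) := y.1.1.1 = x.1.1.1.+1 /\ (inv x -> inv y /\
  [/\ (x.1.1.2 < y.1.1.2)%N,
      forall E, Sigma x.1.1.2 E ->
        (\int[P]_(r in E) (x.1.2 r)%:E = \int[P]_(r in E) (y.1.2 r)%:E)%E &
      forall t, exists2 s, atom x.1.1.2 t s & y.1.2 s = a x.1.1.1]).
have step x : {y | nxt x y}.
  apply: cid; case: x => [[[k m] w] c']; rewrite /nxt /=.
  have [[/= lw c'1 wc]|ni] := pselect (inv (k, m, w, c')); last first.
    by exists (k.+1, m, w, c').
  have [m' [w' [c'' [mm' lw' c''1 w'c [Iw pk]]]]] :=
    level_step lw c'1 wc (a1 k).
  by exists (k.+1, m', w', c'').
have [u [u0 uS]] := dependent_choice step (0%N, n, v, c).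
have uk k : (u k).1.1.1 = k by elim: k => [|k ih]; [rewrite u0|have [-> _] := uS k; rewrite ih].
have uinv k : inv (u k).
  by elim: k => [|k /(proj2 (uS k))[]//]; rewrite u0.
exists (fun k => (u k).1.1.2), (fun k => (u k).1.2); split; rewrite ?u0//.
  move=> k; have [lk /andP[_ ck] uc] := uinv k; split=> // t.
  exact: le_trans (uc t) (ltW ck).
move=> k; have [_ [lt Iu pk]] := proj2 (uS k) (uinv k); split=> // t.
by rewrite -[in a k](uk k); exact: pk.
Qed.

(** The tower [V] lives on the sparse levels [N k].  The martingale is obtained
    on all levels by conditioning: its value at level [j] is the conditional
    expectation of [V j], and equally of any [V i] with [j <= N i]. *)
Lemma Minfty1_extension n (v : T -> R) (c : R) (a : nat -> R) :
  level n v -> 0 <= c < 1 -> (forall t, `|v t| <= c) -> (forall k, `|a k| < 1) ->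
  exists F : Minfty1 P Sigma,
    (forall j t, (j <= n)%N -> seq_fun (\val F) j t = avg j v t) /\
    forall k t, exists2 m, (k <= m)%N &
      exists2 s, atom k t s & seq_fun (\val F) m s = a k.
Proof.
move=> lv c01 vc a1.
have [N [V [N0 V0 VP NV]]] := level_tower lv c01 vc a1.
have lV k : level (N k) (V k) by have [] := VP k.
have V1 k t : `|V k t| <= 1 by have [_] := VP k.
have Nlt k : (N k < N k.+1)%N by have [] := NV k.
have mV k := level_measurable hD (lV k).
have Nmono : {homo N : i j / (i <= j)%N}.
  by apply: homo_leq leq_trans _ => // k; exact: ltnW.
have leN k : (k <= N k)%N by elim: k => // k ih; exact: leq_ltn_trans ih (Nlt k).
have IV i k E : (i <= k)%N -> Sigma (N i) E ->
    (\int[P]_(x in E) (V i x)%:E = \int[P]_(x in E) (V k x)%:E)%E.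
  move=> ik SE; rewrite -(subnKC ik); elim: (k - i)%N => [|j ih]; first by rewrite addn0.
  rewrite addnS ih; have [_ + _] := NV (i + j)%N; apply.
  by apply: (filt_increasing (Nmono _ _ (leq_addr j i))).
have avgV j i t : (j <= N i)%N -> avg j (V j) t = avg j (V i) t.
  move=> jNi; rewrite /avg; congr (fine _ / _).
  have Sj : Sigma j (atom j t) by exact/(sub_Sigma hD)/(D_atom hD).
  have [ij|ji] := leqP i j.
    by rewrite -(IV i j)//; exact: (filt_increasing jNi).
  by rewrite (IV j i) ?(ltnW ji)//; exact: (filt_increasing (leN j)).
have [F FE] : exists F : Minfty1 P Sigma, seq_fun (\val F) = fun j => avg j (V j).
  apply: Minfty1_exists => [j|j t|m j jm E SE]; first exact: avg_level.
    exact: avg_le.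
  rewrite (integral_avg (mV j) (V1 j))// (integral_avg (mV m) (V1 m))//.
    by rewrite (IV j m)//; exact: (filt_increasing (leN j)).
  exact: (filt_increasing jm).
exists F; rewrite FE; split=> [j t jn|k t].
  by rewrite (avgV j 0%N) ?N0// V0.
have [_ _ /(_ t)[s ts Vs]] := NV k.
exists (N k.+1); first exact: ltnW (leq_ltn_trans (leN k) (Nlt k)).
exists s; first exact: (atom_mono hD (leN k)) ts.
by rewrite (avgV _ k.+1)// avg_id.
Qed.

(** * Open and dense oscillation conditions *)

Local Notation M := (Minfty1 P Sigma).
Local Notation K := (branches D).
Local Notation val_at f := (seq_fun (\val f)).
Local Notation node x n := (\val ((\val x : prod_topology _) n)).

Lemma avgZ n (v : T -> R) (c r : R) t :
  measurable_fun setT v -> (forall s, `|v s| <= c) ->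
  avg n (fun x => r * v x) t = r * avg n v t.
Proof.
move=> mv vc; rewrite /avg mulrA; congr (_ / _).
have mE := measurable_atom hD n t.
exact: (RintegralZl r mE (integrable_bounded mE mv vc)).
Qed.

Lemma avg_martingale (f : M) n m t :
  (n <= m)%N -> avg n (val_at f m) t = val_at f n t.
Proof.
move=> nm; rewrite -(avg_id _ (Minfty1_level f (n:=n))) /avg.
by rewrite -(Minfty1_martingale f nm)//; exact/(sub_Sigma hD)/(D_atom hD).
Qed.

Lemma node_atom (x : K) n t : node x n t -> node x n = atom n t.
Proof. by move=> xt; rewrite (atomE hD _ xt)//; exact: set_valP. Qed.

Lemma node_ex (x : K) n : exists t, node x n = atom n t.
Proof. by apply: (D_ex_atom hD); exact: set_valP. Qed.

Lemma eval_atom (f : M) (x : K) n t :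
  node x n = atom n t -> Defs.eval f x n = val_at f n t.
Proof.
move=> xt; rewrite /Defs.eval /value_on xt.
have : (val_at f n @` atom n t) (val_at f n t).
  by exists t => //; exact: (atom_refl hD n t).
by move=> /(xgetI 0)[s ts <-]; exact: (Minfty1_level f ts).
Qed.

(** The sign [(-1) ^+ b] treats peaks near 1 and near -1 uniformly. *)
Lemma oscillatesP (f : M) (x : K) : oscillates f x <->
  forall (b : bool) k,
    exists2 n, (k <= n)%N & 1 - k.+1%:R^-1 < (-1) ^+ b * Defs.eval f x n.
Proof.
have ef n : `|Defs.eval f x n| <= 1.
  by have [t xt] := node_ex x n; rewrite (eval_atom _ xt) Minfty1_le1.
rewrite /oscillates limn_esup_eq1 ?limn_einf_eqN1; last 2 first.
- by move=> n; have := ef n; rewrite ler_norml => /andP[].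
- by move=> n; have := ef n; rewrite ler_norml => /andP[].
split=> [[h1 h2] [] k|h].
- by have [n kn fn] := h2 k; exists n => //; rewrite expr1 mulN1r.
- by have [n kn fn] := h1 k; exists n => //; rewrite expr0 mul1r.
split=> k; [have [n] := h false k|have [n] := h true k].
- by rewrite expr0 mul1r; exists n.
- by rewrite expr1 mulN1r; exists n.
Qed.

Lemma near_val_at (f : M) n (e : R) : 0 < e ->
  \forall g \near f, forall t, `|val_at f n t - val_at g n t| < e.
Proof.
move=> e0; have := near_Minfty1 f n e0; apply: filterS => g fg t.
rewrite -lte_fin; apply: le_lt_trans fg.
apply: (@le_Linfty_norm n (fun t => val_at f n t - val_at g n t)) => r s rs.
by rewrite (Minfty1_level f rs) (Minfty1_level g rs).
Qed.

Lemma near_val_at_gt (f : M) (b : bool) n t (r : R) : r < (-1) ^+ b * val_at f n t ->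
  \forall g \near f, r < (-1) ^+ b * val_at g n t.
Proof.
rewrite -subr_gt0 => /(near_val_at f n); apply: filterS => g /(_ t).
by case: b; rewrite ?expr1 ?expr0 ltr_norml => /andP[]; lra.
Qed.

Definition peaks (b : bool) k : set (M * K) :=
  [set fx | exists2 n, (k <= n)%N &
    1 - k.+1%:R^-1 < (-1) ^+ b * Defs.eval fx.1 fx.2 n].

Lemma open_peaks b k : open (peaks b k).
Proof.
rewrite openE => -[f x] [n kn /= fn].
have [t xt] := node_ex x n; rewrite (eval_atom _ xt) in fn.
exists ([set g : M | 1 - k.+1%:R^-1 < (-1) ^+ b * val_at g n t],
        [set y : K | (\val y : prod_topology _) n = (\val x : prod_topology _) n]).
  by split => /=; [exact: near_val_at_gt fn|exact: near_branches].
move=> [g y] /= [gn yx]; exists n => //=.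
have yt : node y n = atom n t by rewrite -xt; exact: (congr1 val yx).
by rewrite (eval_atom _ yt).
Qed.

Lemma Gdelta_oscillates : Gdelta [set fx : M * K | oscillates fx.1 fx.2].
Proof.
exists (fun k => peaks false k `&` peaks true k).
  by move=> k; apply: openI; exact: open_peaks.
apply/seteqP; split=> fx /=.
  by move=> /oscillatesP h k _; split; exact: h.
by move=> h; apply/oscillatesP => -[] k; have [] := h k I.
Qed.

Lemma Gdelta_section (f : M) : Gdelta [set x : K | oscillates f x].
Proof.
have cf : continuous (fun x : K => (f, x)).
  move=> x A [[B C] /= [Bf Cx] BCA]; apply: filterS Cx => y Cy.
  by apply: BCA; split=> //; exact: nbhs_singleton Bf.
exists (fun k => (fun x : K => (f, x)) @^-1` (peaks false k `&` peaks true k)).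
  move=> k; apply: open_comp => [x _|]; first exact: cf.
  by apply: openI; exact: open_peaks.
apply/seteqP; split=> x /=.
  by move=> /oscillatesP h k _; split; exact: h.
by move=> h; apply/oscillatesP => -[] k; have [] := h k I.
Qed.

(** The condition bears on the nodes of level [k] only; as [k] varies, it gives
    peaks below every node, because each node contains nodes of all later
    levels. *)
Definition peaks_below k : set M := [set f | forall t (b : bool),
  exists2 n, (k <= n)%N &
    exists2 s, atom k t s & 1 - k.+1%:R^-1 < (-1) ^+ b * val_at f n s].

(** Openness uses that there are finitely many nodes of level [k]. *)
Lemma open_peaks_below k : open (peaks_below k).
Proof.
rewrite openE => f fk.
have [/finite_seqP[r Dr] _ _] := hD k.
pose Q E (g : M) := forall b : bool, exists2 n, (k <= n)%N &
  exists2 s, E s & 1 - k.+1%:R^-1 < (-1) ^+ b * val_at g n s.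
have : \forall g \near f, forall E, E \in r -> Q E g.
  apply: near_all_seq => E Er.
  have [t ->] : exists t, E = atom k t by apply: (D_ex_atom hD); rewrite Dr.
  have [n1 kn1 [s1 ts1 fs1]] := fk t true.
  have [n0 kn0 [s0 ts0 fs0]] := fk t false.
  have := near_val_at_gt fs0; have := near_val_at_gt fs1.
  apply: filterS2 => g g1 g0 [].
    by exists n1 => //; exists s1.
  by exists n0 => //; exists s0.
apply: filterS => g gQ t; apply: gQ.
by have := D_atom hD k t; rewrite Dr.
Qed.

Definition targets k : R := (-1) ^+ k * (1 - k.+2%:R^-1).

Lemma inv_succ_lt1 k : 0 < (k.+2%:R : R)^-1 < 1.
Proof. by rewrite invr_gt0 ltr0n invf_lt1 ?ltr0n ?ltr1n. Qed.

Lemma targets_lt1 k : `|targets k| < 1.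
Proof.
rewrite normrM normrX normrN1 expr1n mul1r.
by move: (_^-1) (inv_succ_lt1 k) => r /andP[r0 r1]; rewrite ger0_norm; lra.
Qed.

Lemma targets_gt (b : bool) k : 1 - k.+1%:R^-1 < (-1) ^+ b * targets (b + k.*2).
Proof.
rewrite /targets mulrA -exprD addnA addnn -doubleD -signr_odd odd_double expr0 mul1r.
by rewrite ltrD2l ltrN2 ltf_pV2 ?posrE ?ltr0n// ltr_nat !ltnS -addnn addnA leq_addl.
Qed.

(** Shrinking [f n] by the factor [1 - 1/(n+2)] gives the extension lemma its
    strict bound, at the price of an error at most [1/(n+2)] on the levels up to
    [n]. *)
Lemma dense_peaks_below : dense (\bigcap_k peaks_below k).
Proof.
apply: dense_cvg_seq => f.
pose c n : R := 1 - n.+2%:R^-1.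
have c01 n : 0 <= c n < 1 by rewrite /c; move: (_^-1) (inv_succ_lt1 n) => r /andP[r0 r1]; lra.
have ext n : exists F : M,
    (forall j t, (j <= n)%N ->
      val_at F j t = avg j (fun x => c n * val_at f n x) t) /\
    forall k t, exists2 m, (k <= m)%N &
      exists2 s, atom k t s & val_at F m s = targets k.
  apply: (@Minfty1_extension _ _ (c n)) => // [t s ts|t|]; last exact: targets_lt1.
    by rewrite (Minfty1_level f ts).
  have /andP[cn0 _] := c01 n.
  by rewrite normrM ger0_norm// ler_piMr// Minfty1_le1.
have /choice[u uP] := ext; exists u => [n k _ t b|].
  have [_ /(_ (b + k.*2)%N t)[m km [s ts Fs]]] := uP n.
  exists m; first by apply: leq_trans km; rewrite -addnn addnA leq_addl.
  exists s; first by apply: (atom_mono hD) ts; rewrite -addnn addnA leq_addl.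
  by rewrite Fs; exact: targets_gt.
apply: cvg_Minfty1 => j e e0.
have [n0 _ n0e] := near_infty_natSinv_lt (PosNum e0).
exists (maxn j n0) => // n /=; rewrite geq_max => /andP[jn n0n].
have uj t : val_at (u n) j t = c n * val_at f j t.
  rewrite (proj1 (uP n))// (@avgZ _ _ 1) ?(avg_martingale f)//.
    exact: (level_measurable hD (Minfty1_level f (n:=n))).
  exact: Minfty1_le1.
have : (n.+2%:R^-1 < e).
  by apply: le_lt_trans (n0e n n0n); rewrite lef_pV2 ?posrE ?ltr0n// ler_nat.
rewrite -lte_fin; apply: le_lt_trans.
apply: (@Linfty_norm_le j (fun t => val_at f j t - val_at (u n) j t)) => [|t].
  by rewrite invr_ge0.
rewrite uj -[X in X - _]mul1r -mulrBl /c opprB addrC subrK normrM.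
by rewrite ger0_norm ?invr_ge0// ler_piMr ?invr_ge0// Minfty1_le1.
Qed.

(** Through each node [node x n], a branch is built along which the values come
    close to 1 and to -1 in turn. *)
Lemma dense_section (f : M) :
  (\bigcap_k peaks_below k) f -> dense [set x : K | oscillates f x].
Proof.
move=> fG; apply: dense_cvg_seq => x.
(* Branches through the nodes of x converge to x. *)
suff h n : exists2 y : K, oscillates f y & node y n = node x n.
  have h' n : exists y : K, oscillates f y /\ node y n = node x n.
    by have [y] := h n; exists y.
  have /choice[u uP] := h'; exists u => [n|]; first by have [] := uP n.
  apply: cvg_branches => n; exists n => // k /= nk; apply: val_inj.
  have [t kt] := node_ex x k.
  have [_ uk] := uP k.
  have sub (y : K) : node y k = node x k -> node y n = atom n t.
    move=> yk; apply: node_atom.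
    have /set_mem/(_ k n nk) := valP y; apply.
    by rewrite yk kt; exact: (atom_refl hD k t).
  by rewrite (sub _ uk) (sub x erefl).
have [t0 xt0] := node_ex x n.
(* A state is a level, a point naming the current node, and the sign of the
   next peak. *)
pose nxt (p q : nat * T * bool) := [/\ (p.1.1 < q.1.1)%N, atom p.1.1 p.1.2 q.1.2,
  q.2 = ~~ p.2 & 1 - p.1.1.+1%:R^-1 < (-1) ^+ p.2 * val_at f q.1.1 q.1.2].
have step p : {q | nxt p q}.
  apply: cid; case: p => [[l t] b].
  have [m lm [s ts fs]] := fG l.+1 I t b.
  exists (m, s, ~~ b); split => //=; first exact: (atom_mono hD (leqnSn l)) ts.
  by apply: lt_trans fs; rewrite ltrD2l ltrN2 ltf_pV2 ?posrE ?ltr0n// ltr_nat.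
have [u [u0 uS]] := dependent_choice step (n, t0, false).
pose l i := (u i).1.1; pose t i := (u i).1.2.
have bE i : (u i).2 = odd i.
  by elim: i => [|i ih]; [rewrite u0|have [_ _ -> _] := uS i; rewrite ih].
have lt_l i : (l i < l i.+1)%N by have [] := uS i.
have l_mono : {homo l : i j / (i <= j)%N}.
  by apply: homo_leq leq_trans _ => // i; exact: ltnW.
have le_l i : (i <= l i)%N by elim: i => // i ih; exact: leq_ltn_trans ih (lt_l i).
have nested i j : (i <= j)%N -> atom (l i) (t i) (t j).
  move=> ij; rewrite -(subnKC ij); elim: (j - i)%N => [|k ih].
    by rewrite addn0; exact: (atom_refl hD).
  rewrite addnS -(eq_atom hD ih); apply: (atom_mono hD (l_mono _ _ (leq_addr k i))).
  by have [] := uS (i + k)%N.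
(* Since j <= l j, the node of level l j named by t j determines that of level j. *)
pose y : prod_topology (fun j => discrete_topology (set_type (D j))) :=
  fun j => exist _ (atom j (t j)) (mem_set (D_atom hD j (t j))).
have Ky : y \in K.
  rewrite inE => j i ij /=.
  rewrite -(eq_atom hD (atom_mono hD (le_l i) (nested _ _ ij))).
  exact: (atom_mono hD ij).
have ynode i : atom (l i) (t (l i)) = atom (l i) (t i).
  exact: (eq_atom hD (nested _ _ (le_l i))).
exists (exist _ y Ky); last first.
  by rewrite /= xt0; have := ynode 0%N; rewrite /l /t u0.
apply/oscillatesP => b k.
(* The peak reached at step i has sign (-1)^i. *)
pose i := (b + k.*2)%N.
have ki : (k <= i)%N by rewrite /i -addnn addnA leq_addl.
have oi : odd i = b by rewrite oddD odd_double addbF oddb.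
exists (l i.+1); first exact: leq_trans ki (leq_trans (leqnSn _) (le_l _)).
rewrite (@eval_atom _ _ _ (t i.+1)); last exact: ynode.
have [_ _ _] := uS i; rewrite bE oi; apply: le_lt_trans.
rewrite lerD2l lerN2 lef_pV2 ?posrE ?ltr0n// ler_nat ltnS.
exact: leq_trans ki (le_l i).
Qed.

(** Choose the martingale first, then a branch for it. *)
Lemma dense_oscillates : dense [set fx : M * K | oscillates fx.1 fx.2].
Proof.
move=> O [[f x] Ofx] oO.
have [[A B] /= [Af Bx] ABO] : nbhs (f, x) O by exact: open_nbhs_nbhs.
have Ai : A^° !=set0 by exists f.
have Bi : B^° !=set0 by exists x.
have [g [Ag gG]] := dense_peaks_below Ai (open_interior A).
have [y [By gy]] := dense_section gG Bi (open_interior B).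
by exists (g, y); split => //; apply: ABO; split; exact: interior_subset.
Qed.

End filtration.

Theorem theorem4p5 (R : realType) (d : measure_display) (T : measurableType d)
  (P : probability T R) (Sigma : finite_filtration T) (D : nat -> set (set T))
  (hD : forall n, generating_partition (Sigma n) (D n))
  (hpos : forall n E, D n E -> (0 < P E)%E)
  (hsplit : forall n E, D n E -> exists2 m, (n < m)%N & ~ D m E) :
  let M := set_type (Minfty1 P Sigma) in
  let K := set_type (branches D) in
  (dense [set fx : M * K | oscillates fx.1 fx.2] /\
   Gdelta [set fx : M * K | oscillates fx.1 fx.2]) /\
  exists G : set M, [/\ dense G, Gdelta G &
    forall f : M, G f -> exists H : set K, [/\ dense H, Gdelta H &
      forall x : K, H x -> oscillates f x]].
Proof.
split; first by split; [exact: dense_oscillates|exact: Gdelta_oscillates].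
exists (\bigcap_k @peaks_below _ _ _ P Sigma D k); split.
- exact: dense_peaks_below.
- by exists (@peaks_below _ _ _ P Sigma D) => // k; exact: open_peaks_below.
- move=> f fG; exists [set x | oscillates f x]; split => //.
    exact: dense_section fG.
  exact: Gdelta_section.
Qed.
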